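(* There is an algorithm which, given an arbitrary $m\times n$ interval matrix $\mathbf{M}$, outputs ''YES'' together with a row permutation $\sigma$ and a column permutation $\pi$ such that $\mathbf{M}(\sigma,\pi)$ has the strong Monge property if $\mathbf{M}$ is Monge permutable, and outputs ''NO'' otherwise, and which runs in time $O(m^2+n^2+mn)$.
   Context: An interval matrix $\mathbf{M}=[\underline{M},\overline{M}]$ with real $m\times n$ matrices $\underline{M}\le\overline{M}$ is the set $\{A\in\mathbb{R}^{m\times n}:\underline{M}\le A\le\overline{M}\}$ (entrywise), with entries $\mathbf{m}_{ij}=[\underline{m}_{ij},\overline{m}_{ij}]$. A real matrix $A$ is Monge if $a_{ij}+a_{k\ell}\le a_{i\ell}+a_{kj}$ for all $i<k$, $j<\ell$; an interval matrix has the strong Monge property if every real matrix it contains is Monge. For permutations $\sigma$ of rows and $\pi$ of columns, $\mathbf{M}(\sigma,\pi)$ is the interval matrix with $(i,j)$ entry $\mathbf{m}_{\sigma(i),\pi(j)}$; $\mathbf{M}$ is Monge permutable if there exist $\sigma,\pi$ such that $\mathbf{M}(\sigma,\pi)$ has the strong Monge property. Running time counts arithmetic operations and comparisons on reals at unit cost. *)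

(* Defs.v *)
From HB Require Import structures.
From mathcomp Require Import all_boot all_order all_algebra all_fingroup.
From mathcomp Require Import reals.
Set Implicit Arguments.
Unset Strict Implicit.
Unset Printing Implicit Defensive.
Import Order.TTheory GRing.Theory Num.Theory.
Local Open Scope ring_scope.

(** ** Interval matrices *)

Record interval_mx (R : realType) (m n : nat) := IntervalMx {
  lower : 'M[R]_(m, n);
  upper : 'M[R]_(m, n);
  lower_le_upper : forall i j, lower i j <= upper i j }.

Definition in_interval_mx (R : realType) (m n : nat)
    (M : interval_mx R m n) (A : 'M[R]_(m, n)) : Prop :=
  forall i j, lower M i j <= A i j <= upper M i j.

Definition monge (R : realType) (m n : nat) (A : 'M[R]_(m, n)) : Prop :=
  forall (i k : 'I_m) (j l : 'I_n), (i < k)%N -> (j < l)%N ->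
    A i j + A k l <= A i l + A k j.

Definition strong_monge (R : realType) (m n : nat)
    (M : interval_mx R m n) : Prop :=
  forall A : 'M[R]_(m, n), in_interval_mx M A -> monge A.

Lemma permute_mx_proof (R : realType) (m n : nat) (M : interval_mx R m n)
    (s : 'S_m) (p : 'S_n) (i : 'I_m) (j : 'I_n) :
  (\matrix_(i, j) lower M (s i) (p j)) i j
    <= (\matrix_(i, j) upper M (s i) (p j)) i j.
Proof. by rewrite !mxE lower_le_upper. Qed.

Definition permute_mx (R : realType) (m n : nat) (M : interval_mx R m n)
    (s : 'S_m) (p : 'S_n) : interval_mx R m n :=
  IntervalMx (permute_mx_proof M s p).

Definition monge_permutable (R : realType) (m n : nat)
    (M : interval_mx R m n) : Prop :=
  exists (s : 'S_m) (p : 'S_n), strong_monge (permute_mx M s p).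

(** ** A real RAM

    A program is a finite, uniform text (independent of [m], [n] and the
    matrix).  It owns arrays of natural numbers and arrays of reals, both
    named by [nat]; a scalar variable is a cell of an array.  The input is
    read-only and accessed entry by entry.  Reals support exact [+ - * /] and
    comparison, and reals influence naturals only through branching.

    The only arithmetic on naturals is successor and predecessor, so after [t]
    steps every stored index is at most [max m n + t + O(1)]: charging one unit
    per index operation cannot be abused to compute with huge integers.

    Bookkeeping is charged too: each constant, memory or input access,
    operation, comparison, and each executed command costs one. *)

Inductive iexp : Type :=
  | INat of nat
  | IRows
  | ICols
  | IGet of nat & iexp             (* array name, index *)
  | ISucc of iexp
  | IPred of iexp.

Inductive rexp : Type :=
  | RNat of nat
  | RLower of iexp & iexp
  | RUpper of iexp & iexp
  | RGet of nat & iexp             (* array name, index *)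
  | RAdd of rexp & rexp
  | RSub of rexp & rexp
  | RMul of rexp & rexp
  | RDiv of rexp & rexp.

Inductive bexp : Type :=
  | BILe of iexp & iexp
  | BRLe of rexp & rexp
  | BNot of bexp
  | BAnd of bexp & bexp.

Inductive cmd : Type :=
  | Skip
  | ISet of nat & iexp & iexp      (* array name, index, value *)
  | RSet of nat & iexp & rexp      (* array name, index, value *)
  | Seq of cmd & cmd
  | If of bexp & cmd & cmd
  | While of bexp & cmd.

Fixpoint icost (e : iexp) : nat :=
  match e with
  | INat _ | IRows | ICols => 1
  | IGet _ e1 | ISucc e1 | IPred e1 => (icost e1).+1
  end.

Fixpoint rcost (e : rexp) : nat :=
  match e with
  | RNat _ => 1
  | RLower e1 e2 | RUpper e1 e2 => (icost e1 + icost e2).+1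
  | RGet _ e1 => (icost e1).+1
  | RAdd e1 e2 | RSub e1 e2 | RMul e1 e2 | RDiv e1 e2 =>
      (rcost e1 + rcost e2).+1
  end.

Fixpoint bcost (b : bexp) : nat :=
  match b with
  | BILe e1 e2 => (icost e1 + icost e2).+1
  | BRLe e1 e2 => (rcost e1 + rcost e2).+1
  | BNot b1 => (bcost b1).+1
  | BAnd b1 b2 => (bcost b1 + bcost b2).+1
  end.

Record state (R : realType) := State {
  imem : nat -> nat -> nat;        (* array name, index *)
  rmem : nat -> nat -> R }.

Definition init_state (R : realType) : state R :=
  State (fun _ _ => 0%N) (fun _ _ => 0).

Definition update (T : Type) (f : nat -> nat -> T) (a i : nat) (v : T) :
    nat -> nat -> T :=
  fun b k => if (b == a) && (k == i) then v else f b k.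

(* Reading outside the matrix yields 0. *)
Definition entry (R : realType) (m n : nat) (A : 'M[R]_(m, n)) (i j : nat) : R :=
  match (insub i : option 'I_m), (insub j : option 'I_n) with
  | Some i', Some j' => A i' j'
  | _, _ => 0
  end.

Fixpoint ieval (R : realType) (m n : nat) (s : state R) (e : iexp) : nat :=
  match e with
  | INat k => k
  | IRows => m
  | ICols => n
  | IGet a e1 => imem s a (ieval m n s e1)
  | ISucc e1 => (ieval m n s e1).+1
  | IPred e1 => (ieval m n s e1).-1
  end.

Fixpoint reval (R : realType) (m n : nat) (M : interval_mx R m n)
    (s : state R) (e : rexp) : R :=
  match e with
  | RNat k => k%:R
  | RLower e1 e2 => entry (lower M) (ieval m n s e1) (ieval m n s e2)
  | RUpper e1 e2 => entry (upper M) (ieval m n s e1) (ieval m n s e2)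
  | RGet a e1 => rmem s a (ieval m n s e1)
  | RAdd e1 e2 => reval M s e1 + reval M s e2
  | RSub e1 e2 => reval M s e1 - reval M s e2
  | RMul e1 e2 => reval M s e1 * reval M s e2
  | RDiv e1 e2 => reval M s e1 / reval M s e2
  end.

Fixpoint beval (R : realType) (m n : nat) (M : interval_mx R m n)
    (s : state R) (b : bexp) : bool :=
  match b with
  | BILe e1 e2 => (ieval m n s e1 <= ieval m n s e2)%N
  | BRLe e1 e2 => reval M s e1 <= reval M s e2
  | BNot b1 => ~~ beval M s b1
  | BAnd b1 b2 => beval M s b1 && beval M s b2
  end.

(* [exec M c s t s']: on input [M], command [c] started in [s] halts in [s']
   after [t] time units. *)
Inductive exec (R : realType) (m n : nat) (M : interval_mx R m n) :
    cmd -> state R -> nat -> state R -> Prop :=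
  | ExecSkip s : exec M Skip s 1 s
  | ExecISet s a e v :
      exec M (ISet a e v) s (icost e + icost v).+1
        (State (update (imem s) a (ieval m n s e) (ieval m n s v)) (rmem s))
  | ExecRSet s a e v :
      exec M (RSet a e v) s (icost e + rcost v).+1
        (State (imem s) (update (rmem s) a (ieval m n s e) (reval M s v)))
  | ExecSeq c1 c2 s s1 s2 t1 t2 :
      exec M c1 s t1 s1 -> exec M c2 s1 t2 s2 ->
      exec M (Seq c1 c2) s (t1 + t2).+1 s2
  | ExecIfTrue b c1 c2 s s1 t1 :
      beval M s b -> exec M c1 s t1 s1 ->
      exec M (If b c1 c2) s (bcost b + t1).+1 s1
  | ExecIfFalse b c1 c2 s s1 t1 :
      ~~ beval M s b -> exec M c2 s t1 s1 ->
      exec M (If b c1 c2) s (bcost b + t1).+1 s1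
  | ExecWhileTrue b c s s1 s2 t1 t2 :
      beval M s b -> exec M c s t1 s1 -> exec M (While b c) s1 t2 s2 ->
      exec M (While b c) s (bcost b + t1 + t2).+1 s2
  | ExecWhileFalse b c s :
      ~~ beval M s b -> exec M (While b c) s (bcost b).+1 s.

(* A program has at most one outcome and one running time on a given input, so
   asserting the existence of an execution describes the execution. *)
Lemma exec_det (R : realType) (m n : nat) (M : interval_mx R m n)
    (c : cmd) (s s1 s2 : state R) (t1 t2 : nat) :
  exec M c s t1 s1 -> exec M c s t2 s2 -> t1 = t2 /\ s1 = s2.
Proof.
move=> H; elim: H t2 s2 => {c s s1 t1}
  [s|s a e v|s a e v|c1 c2 s s1 s2 t1 t2 _ IH1 _ IH2|b c1 c2 s s1 t1 hb _ IH
  |b c1 c2 s s1 t1 hb _ IH|b c s s1 s2 t1 t2 hb _ IH1 _ IH2|b c s hb] t s' H;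
  inversion H; subst => //;
  repeat match goal with
  | h : is_true ?b, h' : is_true (~~ ?b) |- _ => by rewrite h in h'
  | IH : (forall t s, exec M ?c ?s0 t s -> _), h : exec M ?c ?s0 _ _ |- _ =>
      case: (IH _ _ h) => ? ?; subst; clear h
  end; by [].
Qed.

(** Output convention: cell 0 of index array 0 holds the answer (1 for YES,
    0 for NO); for YES, index arrays 1 and 2 hold the (0-based) row and column
    permutations. *)

Definition outputs_yes (R : realType) (m n : nat) (s : state R)
    (sigma : 'S_m) (pi : 'S_n) : Prop :=
  [/\ imem s 0 0 = 1%N,
      forall i : 'I_m, imem s 1 i = sigma i
    & forall j : 'I_n, imem s 2 j = pi j].

Definition outputs_no (R : realType) (s : state R) : Prop :=
  imem s 0 0 = 0%N.

(* Main.v *)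
(** Write [A] for the real matrix [lower M + upper M], twice the midpoint of [M],
    and [E(x,x';y,y') = A x y + A x' y' - A x y' - A x' y].  If [M] is Monge
    permutable, then every pair of orders making [A] Monge works for [M]: where
    [E] is nonzero it forces the relative orientation, and where it vanishes the
    four intervals must be points.  So it suffices to order the rows and columns
    of [A] and to test the adjacent 2x2 submatrices of [M].

    In a Monge order of the columns, every [E(0,k;y,y')] moves monotonically, so
    [d(y,y') = \sum_k E(0,k;y,y')^2] increases away from either end of the order,
    and columns at distance 0 are interchangeable.  Hence a column [e] farthest
    from column 0 is an end, and sorting by [d(e,.)] orders the columns.  If [p]
    and [q] are the first and the last column, then sorting by [A x p - A x q]
    orders the rows. *)

Require Import Defs.
From mathcomp Require Import all_boot all_order all_algebra all_fingroup.
From mathcomp Require Import reals.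
From mathcomp Require Import ring lra zify.

Set Implicit Arguments.
Unset Strict Implicit.
Unset Printing Implicit Defensive.
Import Order.TTheory GRing.Theory Num.Theory.
Local Open Scope ring_scope.

(** * Real matrices: orders with the Monge property and distances between columns *)

Definition cross (R : realType) (I J : Type) (A : I -> J -> R)
    (x x' : I) (y y' : J) : R :=
  A x y + A x' y' - A x y' - A x' y.

(** Orders are given by real keys and compared non-strictly: tied rows or columns satisfy the
    inequality in both orientations, so their crosses vanish and ties may be broken arbitrarily. *)
Definition compatible (R : realType) (I J : Type) (A : I -> J -> R)
    (r : I -> R) (c : J -> R) : Prop :=
  forall x x' y y', r x <= r x' -> c y <= c y' -> cross A x x' y y' <= 0.

(** Squared Euclidean distance between two columns once row [x0] has been subtracted from every
    row. *)
Definition sqdist (R : realType) (I : finType) (J : Type) (A : I -> J -> R)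
    (x0 : I) (y y' : J) : R :=
  \sum_k cross A x0 k y y' ^+ 2.

Lemma crossD (R : realType) (I J : Type) (A : I -> J -> R) x x' y y' y'' :
  cross A x x' y y' + cross A x x' y' y'' = cross A x x' y y''.
Proof. by rewrite /cross; ring. Qed.

Lemma crossNr (R : realType) (I J : Type) (A : I -> J -> R) x x' y y' :
  cross A x x' y' y = - cross A x x' y y'.
Proof. by rewrite /cross; ring. Qed.

Lemma crossNl (R : realType) (I J : Type) (A : I -> J -> R) x x' y y' :
  cross A x' x y y' = - cross A x x' y y'.
Proof. by rewrite /cross; ring. Qed.

Lemma compatibleN (R : realType) (I J : Type) (A : I -> J -> R) r c :
  compatible A r c -> compatible A (fun x => - r x) (fun y => - c y).
Proof.
move=> Arc x x' y y'; rewrite !lerN2 => rx cy.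
by rewrite crossNl crossNr opprK Arc.
Qed.

Lemma sqdistC (R : realType) (I : finType) (J : Type) (A : I -> J -> R) x0 y y' :
  sqdist A x0 y y' = sqdist A x0 y' y.
Proof. by apply: eq_bigr => k _; rewrite crossNr sqrrN. Qed.

(** A sum of squares that vanishes kills every cross based at [x0], and any cross is a difference of
    two of those. *)
Lemma sqdist_le0 (R : realType) (I : finType) (J : Type) (A : I -> J -> R)
    x0 y y' x x' :
  sqdist A x0 y y' <= 0 -> cross A x x' y y' = 0.
Proof.
move=> d_le0.
have cross0 k : cross A x0 k y y' = 0.
  have: sqdist A x0 y y' == 0.
    by rewrite eq_le d_le0 sumr_ge0 // => ? _; rewrite sqr_ge0.
  rewrite psumr_eq0 => [/allP/(_ k (mem_index_enum k))|? _]; last first.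
    by rewrite sqr_ge0.
  by rewrite /= sqrf_eq0 => /eqP.
have -> : cross A x x' y y' = cross A x0 x' y y' - cross A x0 x y y'.
  by rewrite /cross; ring.
by rewrite !cross0 subrr.
Qed.

(* The crosses being summed have the same sign, so [(a + b)^2 >= a^2 + b^2]. *)
Lemma sqdist_superadditive (R : realType) (I : finType) (J : Type)
    (A : I -> J -> R) r c x0 y y' y'' :
  compatible A r c -> c y <= c y' -> c y' <= c y'' ->
  sqdist A x0 y y' + sqdist A x0 y' y'' <= sqdist A x0 y y''.
Proof.
move=> Arc cy cy'; rewrite /sqdist -big_split /=; apply: ler_sum => k _.
rewrite -(crossD A x0 k y y' y'').
suff: 0 <= cross A x0 k y y' * cross A x0 k y' y'' by nra.
have [rk|/ltW rk] := leP (r x0) (r k).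
  by rewrite -mulrNN mulr_ge0 // oppr_ge0 Arc.
by rewrite mulr_ge0 // crossNl oppr_ge0 Arc.
Qed.

(** Being farthest from [y0] on the upper side makes [e] interchangeable with the last column [z],
    and the distance to [z] decreases along [c]; hence the minus sign. *)
Lemma compatible_sqdist_aux (R : realType) (I J : finType) (A : I -> J -> R)
    r c x0 y0 e :
  compatible A r c -> c y0 <= c e ->
  (forall y, sqdist A x0 y0 y <= sqdist A x0 y0 e) ->
  compatible A r (fun y => - sqdist A x0 e y).
Proof.
move=> Arc ce emax x x' y y' rx; rewrite lerN2 => dy.
have [z cz]: exists z, forall y, c y <= c z.
  by case: (Order.TotalTheory.arg_maxP c (erefl (predT e))) => z _ cz; exists z => ?; exact: cz.
(* Superadditivity gives d(y0,e) + d(e,z) <= d(y0,z) <= d(y0,e). *)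
have ez k k' : cross A k k' e z = 0.
  apply: (@sqdist_le0 _ _ _ _ x0).
  have := sqdist_superadditive x0 Arc ce (cz e); have := emax z; lra.
have dz v : sqdist A x0 e v = sqdist A x0 v z.
  rewrite sqdistC; apply: eq_bigr => k _.
  by rewrite -(crossD A x0 k v e z) ez addr0.
have [cy|/ltW cy] := leP (c y) (c y'); first exact: Arc.
(* Here [c] and the new key disagree; superadditivity along [y'], [y], [z] then forces d(y',y) =
   0. *)
rewrite crossNr (@sqdist_le0 _ _ _ _ x0) ?oppr0 //.
have := sqdist_superadditive x0 Arc cy (cz y); rewrite -!dz; lra.
Qed.

(** The side of [y0] on which [e] lies is unknown; reversing both orders exchanges the two cases, so
    [r'] is [r] or its opposite. *)
Lemma compatible_sqdist (R : realType) (I J : finType) (A : I -> J -> R)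
    r c x0 y0 e :
  compatible A r c ->
  (forall y, sqdist A x0 y0 y <= sqdist A x0 y0 e) ->
  exists r', compatible A r' (sqdist A x0 e).
Proof.
move=> Arc emax; have [ce|/ltW ce] := leP (c y0) (c e).
  exists (fun x => - r x) => x x' y y' rx dy.
  apply: (compatibleN (compatible_sqdist_aux Arc ce emax)) => //.
  by rewrite !opprK.
exists r => x x' y y' rx dy.
have ce' : - c y0 <= - c e by rewrite lerN2.
have := compatibleN (compatible_sqdist_aux (compatibleN Arc) ce' emax).
by move/(_ x x' y y'); rewrite !opprK; exact.
Qed.

(** The difference of two row keys is the cross over [p] and [q], which splits at [y] and [y'] into
    three crosses of one sign. If the key contradicts [r], their sum has the opposite sign and all
    three vanish. *)
Lemma compatible_ends (R : realType) (I J : Type) (A : I -> J -> R) r c p q :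
  compatible A r c -> (forall y, c p <= c y <= c q) ->
  compatible A (fun x => A x p - A x q) c.
Proof.
move=> Arc pq x x' y y' Hx cy.
have [rx|/ltW rx] := leP (r x) (r x'); first exact: Arc.
have /andP[py _] := pq y; have /andP[_ yq] := pq y'.
move: (Arc _ _ _ _ rx py) (Arc _ _ _ _ rx cy) (Arc _ _ _ _ rx yq) Hx.
rewrite /cross; lra.
Qed.

(** * Interval matrices: 2x2 criteria and transfer from endpoint sums *)

Definition interval_monge4 (R : realType) (m n : nat) (M : interval_mx R m n)
    (x x' : 'I_m) (y y' : 'I_n) : bool :=
  upper M x y + upper M x' y' <= lower M x y' + lower M x' y.

Lemma strong_mongeP (R : realType) (m n : nat) (M : interval_mx R m n) :
  strong_monge M <->
  forall (i k : 'I_m) (j l : 'I_n), (i < k)%N -> (j < l)%N ->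
    interval_monge4 M i k j l.
Proof.
split=> [sM i k j l ik jl|adj B BM i k j l ik jl]; last first.
  have := adj i k j l ik jl; rewrite /interval_monge4.
  move: (BM i j) (BM i l) (BM k j) (BM k l) => /andP[_ ?] /andP[? _] /andP[? _] /andP[_ ?].
  lra.
(* The worst member of [M] for this quadruple: upper endpoints at the two diagonal positions, lower
   endpoints elsewhere. *)
pose B : 'M_(m, n) := \matrix_(a, b)
  if ((a == i) && (b == j)) || ((a == k) && (b == l)) then upper M a b
  else lower M a b.
have BM : in_interval_mx M B.
  by move=> a b; rewrite !mxE; case: ifP => _; rewrite lexx lower_le_upper.
have := sM B BM i k j l ik jl; rewrite !mxE !eqxx /=.
have neq (a : nat) (x y : 'I_a) : (x < y)%N -> ((x == y) = false) * ((y == x) = false).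
  by move=> xy; split; apply/negbTE; rewrite neq_ltn xy ?orbT.
by rewrite !(neq _ _ _ ik) !(neq _ _ _ jl).
Qed.

Lemma strong_monge_permuteP (R : realType) (m n : nat) (M : interval_mx R m n)
    (s : 'S_m) (p : 'S_n) :
  strong_monge (permute_mx M s p) <->
  forall (i k : 'I_m) (j l : 'I_n), (i < k)%N -> (j < l)%N ->
    interval_monge4 M (s i) (s k) (p j) (p l).
Proof.
rewrite strong_mongeP; split=> H i k j l ik jl.
  by move: (H i k j l ik jl); rewrite /interval_monge4 /= !mxE.
by move: (H i k j l ik jl); rewrite /interval_monge4 /= !mxE.
Qed.

Definition endpoint_sum (R : realType) (m n : nat) (M : interval_mx R m n)
    (x : 'I_m) (y : 'I_n) : R :=
  lower M x y + upper M x y.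

Lemma compatible_permutable (R : realType) (m n : nat) (M : interval_mx R m n) :
  monge_permutable M ->
  exists r c, compatible (endpoint_sum M) r c.
Proof.
case=> s [p] /strong_monge_permuteP H.
(* [s] and [p] send positions to rows and columns, so their inverses give the positions used as
   keys. *)
exists (fun x => ((s^-1)%g x)%:R), (fun y => ((p^-1)%g y)%:R) => x x' y y'.
rewrite !ler_nat.
have [<-|nx] := eqVneq x x'; first by rewrite /cross; lra.
have [<-|ny] := eqVneq y y'; first by rewrite /cross; lra.
have neq (a : nat) (t : 'S_a) u v : u != v ->
    ((t^-1)%g u <= (t^-1)%g v)%N -> ((t^-1)%g u < (t^-1)%g v)%N.
  by move=> uv; rewrite leq_eqVlt (inj_eq val_inj) (inj_eq perm_inj) (negbTE uv).
move=> /(neq _ _ _ _ nx) lx /(neq _ _ _ _ ny) ly.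
have := H _ _ _ _ lx ly; rewrite !permKV /interval_monge4 /cross /endpoint_sum.
have := (lower_le_upper M x y, lower_le_upper M x y', lower_le_upper M x' y,
  lower_le_upper M x' y').
case=> [[[]]]; lra.
Qed.

(* If the given order is not the one witnessing permutability, then the cross
   of the endpoint sums vanishes and the four intervals are points. *)
Lemma interval_monge4_compatible (R : realType) (m n : nat)
    (M : interval_mx R m n) r c x x' y y' :
  monge_permutable M -> compatible (endpoint_sum M) r c ->
  x != x' -> y != y' -> r x <= r x' -> c y <= c y' ->
  interval_monge4 M x x' y y'.
Proof.
case=> s [p] /strong_monge_permuteP H Arc nx ny rx cy.
have := Arc _ _ _ _ rx cy; rewrite /cross /endpoint_sum => cross_le0.
have := (lower_le_upper M x y, lower_le_upper M x y', lower_le_upper M x' y,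
  lower_le_upper M x' y') => -[[[w1 w2] w3] w4].
have neq (a : nat) (t : 'S_a) u v : u != v ->
    ((t^-1)%g u < (t^-1)%g v)%N || ((t^-1)%g v < (t^-1)%g u)%N.
  by move=> uv; rewrite -neq_ltn (inj_eq val_inj) (inj_eq perm_inj).
have /orP[lx|lx] := neq _ s _ _ nx; have /orP[ly|ly] := neq _ p _ _ ny;
  by move: (H _ _ _ _ lx ly); rewrite !permKV /interval_monge4; lra.
Qed.

Lemma strong_monge_sorted (R : realType) (m n : nat) (M : interval_mx R m n)
    r c (s : 'S_m) (p : 'S_n) :
  monge_permutable M -> compatible (endpoint_sum M) r c ->
  (forall i k : 'I_m, (i < k)%N -> r (s i) <= r (s k)) ->
  (forall j l : 'I_n, (j < l)%N -> c (p j) <= c (p l)) ->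
  strong_monge (permute_mx M s p).
Proof.
move=> permM Arc rs cp; apply/strong_monge_permuteP => i k j l ik jl.
apply: (interval_monge4_compatible permM Arc); rewrite ?(inj_eq perm_inj);
  by rewrite ?rs ?cp // neq_ltn ?ik ?jl.
Qed.

(* Intermediate entries cancel because [lower <= upper]. *)
Lemma strong_monge_adjacent (R : realType) (m n : nat) (M : interval_mx R m n) :
  (forall (i k : 'I_m) (j l : 'I_n), k = i.+1 :> nat -> l = j.+1 :> nat ->
     interval_monge4 M i k j l) ->
  strong_monge M.
Proof.
move=> adj; apply/strong_mongeP.
have row1 (i k : 'I_m) (j l : 'I_n) :
    k = i.+1 :> nat -> (j < l)%N -> interval_monge4 M i k j l.
  move=> ik; case: l => l ln /=; elim: l ln => // l IH ln.
  rewrite ltnS leq_eqVlt => /orP[/eqP jl|jl].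
    by apply: adj; rewrite //= jl.
  have := IH (ltnW ln) jl.
  have := adj i k (Ordinal (ltnW ln)) (Ordinal ln) ik erefl.
  have := lower_le_upper M i (Ordinal (ltnW ln)).
  have := lower_le_upper M k (Ordinal (ltnW ln)).
  rewrite /interval_monge4; lra.
move=> i [k km] j l /= + jl; elim: k km => // k IH km.
rewrite ltnS leq_eqVlt => /orP[/eqP ik|ik].
  by apply: row1; rewrite //= ik.
have := IH (ltnW km) ik.
have := row1 (Ordinal (ltnW km)) (Ordinal km) j l erefl jl.
have := lower_le_upper M (Ordinal (ltnW km)) j.
have := lower_le_upper M (Ordinal (ltnW km)) l.
rewrite /interval_monge4; lra.
Qed.

(** * Sorting by counting predecessors *)

Definition precedes (R : realType) (key : nat -> R) (l j : nat) : bool :=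
  (key l <= key j) && ~~ ((key j <= key l) && (j <= l)%N).

(** The position of [j] in the stable sorted order. Computing it by counting costs quadratic time in
    all, which the budget allows. *)
Definition rank (R : realType) (n : nat) (key : nat -> R) (j : nat) : nat :=
  \sum_(l < n) precedes key l j.

(** The strict lexicographic order on key and index; the definition of [precedes] uses only the
    tests available in [bexp]. *)
Lemma precedesE (R : realType) (key : nat -> R) l j :
  precedes key l j = (key l < key j) || (key l == key j) && (l < j)%N.
Proof. by rewrite /precedes ltnNge; case: ltgtP. Qed.

Lemma precedes_irr (R : realType) (key : nat -> R) j : precedes key j j = false.
Proof. by rewrite precedesE ltxx ltnn andbF. Qed.

Lemma precedes_trans (R : realType) (key : nat -> R) : transitive (precedes key).
Proof.
move=> l j k; rewrite !precedesE => /orP[jl|/andP[/eqP-> jl]].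
  by case/orP=> [/(lt_trans jl)->//|/andP[/eqP<- _]]; rewrite jl.
by case/orP=> [->//|/andP[-> /(ltn_trans jl)->]]; rewrite orbT.
Qed.

Lemma precedes_total (R : realType) (key : nat -> R) j l :
  j != l -> precedes key j l || precedes key l j.
Proof. by rewrite !precedesE neq_ltn; case: ltgtP. Qed.

Lemma rank_mono (R : realType) (n : nat) (key : nat -> R) (j l : 'I_n) :
  precedes key j l -> (rank n key j < rank n key l)%N.
Proof.
move=> jl; rewrite /rank (bigD1 j) //= [ltnRHS](bigD1 j) //= precedes_irr jl.
rewrite ltnS leq_sum // => x _; case xj: (precedes key x j) => //.
by rewrite (precedes_trans xj jl).
Qed.

(** Ranks are below [n] and pairwise distinct, hence form a permutation from indices to positions;
    the sorting permutation [p] is its inverse. *)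
Lemma rank_perm (R : realType) (n : nat) (key : nat -> R) :
  exists p : 'S_n,
    (forall j : 'I_n, rank n key j = (p^-1)%g j) /\
    (forall i k : 'I_n, (i < k)%N -> key (p i) <= key (p k)).
Proof.
have rank_lt (j : 'I_n) : (rank n key j < n)%N.
  rewrite -[X in (_ < X)%N]card_ord -sum1_card /rank (bigD1 j) //= [ltnRHS](bigD1 j) //=.
  by rewrite precedes_irr add0n add1n ltnS leq_sum // => l _; case: precedes.
have inj : injective (fun j => Ordinal (rank_lt j)).
  move=> j l [] jl; apply/eqP; apply: contraT => /(precedes_total key).
  by case/orP=> /rank_mono; rewrite jl ltnn.
exists (perm inj)^-1%g; split=> [j|i k ik]; first by rewrite invgK permE.
set p := (perm inj)^-1%g; rewrite leNgt; apply/negP => ki.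
have := @rank_mono _ n key (p k) (p i); rewrite /precedes ltW // leNgt ki /=.
have rankp (x : 'I_n) : rank n key (p x) = x.
  by have /(congr1 val) := permE inj (p x); rewrite permKV.
by rewrite !rankp => /(_ isT); rewrite ltnNge ltnW.
Qed.

(** * A program logic with time bounds and a frame rule *)

Fixpoint iwrites (c : cmd) : seq nat :=
  match c with
  | ISet a _ _ => [:: a]
  | Seq c1 c2 | If _ c1 c2 => iwrites c1 ++ iwrites c2
  | While _ c1 => iwrites c1
  | _ => [::]
  end.

Fixpoint rwrites (c : cmd) : seq nat :=
  match c with
  | RSet a _ _ => [:: a]
  | Seq c1 c2 | If _ c1 c2 => rwrites c1 ++ rwrites c2
  | While _ c1 => rwrites c1
  | _ => [::]
  end.

Definition preserves (R : realType) (iw rw : seq nat) (s s' : state R) : Prop :=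
  (forall a k, a \notin iw -> imem s' a k = imem s a k) /\
  (forall a k, a \notin rw -> rmem s' a k = rmem s a k).

(** The frame rule: loop invariants need to speak only of the arrays that the loop writes. *)
Lemma exec_preserves (R : realType) (m n : nat) (M : interval_mx R m n) c s t s' :
  exec M c s t s' -> preserves (iwrites c) (rwrites c) s s'.
Proof.
elim=> {c s t s'} //=.
- by move=> s a e v; split=> // b k; rewrite /= /update inE => /negbTE ->.
- by move=> s a e v; split=> // b k; rewrite /= /update inE => /negbTE ->.
- move=> c1 c2 s s1 s2 t1 t2 _ [i1 r1] _ [i2 r2].
  by split=> a k; rewrite mem_cat negb_or => /andP[h1 h2];
    rewrite ?i2 ?i1 ?r2 ?r1.
- move=> b c1 c2 s s1 t1 _ _ [i1 r1].
  by split=> a k; rewrite mem_cat negb_or => /andP[h1 h2]; rewrite ?i1 ?r1.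
- move=> b c1 c2 s s1 t1 _ _ [i1 r1].
  by split=> a k; rewrite mem_cat negb_or => /andP[h1 h2]; rewrite ?i1 ?r1.
- move=> b c s s1 s2 t1 t2 _ _ [i1 r1] _ [i2 r2].
  by split=> a k h; rewrite ?i2 ?i1 ?r2 ?r1.
Qed.

(** Total correctness: termination is part of the claim, and [T] is only an upper bound, so that all
    rounds of a loop can be charged alike. *)
Definition wp (R : realType) (m n : nat) (M : interval_mx R m n) (c : cmd)
    (T : nat) (Q : state R -> Prop) (s : state R) : Prop :=
  exists t s', [/\ exec M c s t s', (t <= T)%N & Q s'].

Lemma wp_weaken (R : realType) (m n : nat) (M : interval_mx R m n) c T T'
    (Q Q' : state R -> Prop) s :
  wp M c T Q s -> (T <= T')%N ->
  (forall s', preserves (iwrites c) (rwrites c) s s' -> Q s' -> Q' s') ->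
  wp M c T' Q' s.
Proof.
move=> [t [s' [es tT Qs]]] TT' QQ'; exists t, s'; split=> //.
  exact: leq_trans TT'.
exact: (QQ' _ (exec_preserves es)).
Qed.

Lemma wp_skip (R : realType) (m n : nat) (M : interval_mx R m n)
    (Q : state R -> Prop) s :
  Q s -> wp M Skip 1 Q s.
Proof. by exists 1%N, s; split=> //; exact: ExecSkip. Qed.

Lemma wp_iset (R : realType) (m n : nat) (M : interval_mx R m n) a e v
    (Q : state R -> Prop) s :
  Q (State (update (imem s) a (ieval m n s e) (ieval m n s v)) (rmem s)) ->
  wp M (ISet a e v) (icost e + icost v).+1 Q s.
Proof. by move=> Qs; eexists _, _; split; [exact: ExecISet| | ]. Qed.

Lemma wp_rset (R : realType) (m n : nat) (M : interval_mx R m n) a e v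
    (Q : state R -> Prop) s :
  Q (State (imem s) (update (rmem s) a (ieval m n s e) (reval M s v))) ->
  wp M (RSet a e v) (icost e + rcost v).+1 Q s.
Proof. by move=> Qs; eexists _, _; split; [exact: ExecRSet| | ]. Qed.

Lemma wp_seq (R : realType) (m n : nat) (M : interval_mx R m n) c1 c2 T1 T2
    (Q : state R -> Prop) s :
  wp M c1 T1 (wp M c2 T2 Q) s -> wp M (Seq c1 c2) (T1 + T2).+1 Q s.
Proof.
move=> [t1 [s1 [e1 h1 [t2 [s2 [e2 h2 Q2]]]]]].
by eexists _, _; split; [exact: ExecSeq e1 e2|rewrite ltnS leq_add|].
Qed.

Lemma wp_if (R : realType) (m n : nat) (M : interval_mx R m n) b c1 c2 T
    (Q : state R -> Prop) s :
  (beval M s b -> wp M c1 T Q s) -> (~~ beval M s b -> wp M c2 T Q s) ->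
  wp M (If b c1 c2) (bcost b + T).+1 Q s.
Proof.
move=> h1 h2; have [hb|hb] := boolP (beval M s b).
  have [t [s' [es tT Qs]]] := h1 hb.
  by eexists _, _; split; [exact: ExecIfTrue es|rewrite ltnS leq_add2l|].
have [t [s' [es tT Qs]]] := h2 hb.
by eexists _, _; split; [exact: ExecIfFalse es|rewrite ltnS leq_add2l|].
Qed.

Definition ivar (a : nat) : iexp := IGet a (INat 0).

Definition for_loop (v : nat) (e : iexp) (c : cmd) : cmd :=
  Seq (ISet v (INat 0) (INat 0))
    (While (BNot (BILe e (ivar v)))
       (Seq c (ISet v (INat 0) (ISucc (ivar v))))).

(** On top of its body a round pays [icost e + 4] for the test, 5 for the increment and 2 for the
    sequence and the loop. The invariant is re-established after the increment, and the body may
    rely on the frame since the start. *)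
Lemma wp_for (R : realType) (m n : nat) (M : interval_mx R m n) (v : nat) e c T N
    (I : nat -> state R -> Prop) s :
  v \notin iwrites c ->
  (forall s' : state R, ieval m n s' e = N) ->
  I 0 (State (update (imem s) v 0 0) (rmem s)) ->
  (forall i s', (i < N)%N -> preserves (v :: iwrites c) (rwrites c) s s' ->
     imem s' v 0 = i -> I i s' ->
     wp M c T (fun s1 => I i.+1 (State (update (imem s1) v 0 i.+1) (rmem s1))) s') ->
  wp M (for_loop v e c) (N * (T + (icost e + 11)) + (icost e + 10)) (I N) s.
Proof.
move=> vc eN I0 step.
set s0 := State _ _ in I0.
rewrite /for_loop; set w := While _ _.
(* Induction on the number [k] of rounds left. *)
suff loop k i s' : (i + k = N)%N -> preserves (v :: iwrites c) (rwrites c) s s' ->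
    imem s' v 0 = i -> I i s' ->
    wp M w (k * (T + (icost e + 11)) + (icost e + 5)) (I N) s'.
  have -> : (N * (T + (icost e + 11)) + (icost e + 10) =
    (4 + (N * (T + (icost e + 11)) + (icost e + 5))).+1)%N by lia.
  apply: wp_seq; apply: (@wp_weaken _ _ _ _ _ 3 _
      (wp M w (N * (T + (icost e + 11)) + (icost e + 5)) (I N))) => //.
  apply: wp_iset; apply: (loop N 0%N) => //=; rewrite /update ?eqxx //.
  by split=> //= a k; rewrite inE negb_or => /andP[/negbTE ->].
elim: k i s' => [|k IH] i s' iN ss' vi Ii.
  rewrite addn0 in iN; exists (bcost (BNot (BILe e (ivar v)))).+1, s'.
  split; last by rewrite -iN.
    by apply: ExecWhileFalse; rewrite /= eN vi iN leqnn.
  by rewrite /=; lia.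
have [t [s1 [es tT I1]]] := step i s' ltac:(lia) ss' vi Ii.
have pres1 := exec_preserves es.
set s2 := State _ _ in I1.
have v1 : imem s1 v 0 = i by rewrite pres1.1.
have ss2 : preserves (v :: iwrites c) (rwrites c) s s2.
  split=> a j ha /=.
    move: (ha); rewrite inE negb_or /update => /andP[/negbTE -> /= hc].
    by rewrite pres1.1 // ss'.1.
  by rewrite pres1.2 // ss'.2.
have v2 : imem s2 v 0 = i.+1 by rewrite /= /update !eqxx.
have [t2 [s3 [es2 tT2 I3]]] := IH i.+1 s2 ltac:(lia) ss2 v2 I1.
exists (bcost (BNot (BILe e (ivar v))) + (t + 5).+1 + t2).+1, s3; split=> //.
  apply: ExecWhileTrue es2; first by rewrite /= eN vi -ltnNge; lia.
  apply: ExecSeq es _.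
  have := @ExecISet _ _ _ M s1 v (INat 0) (ISucc (ivar v)).
  by rewrite /= v1.
move: tT2; rewrite /=; lia.
Qed.

Lemma wp_le (R : realType) (m n : nat) (M : interval_mx R m n) c T T'
    (Q : state R -> Prop) s :
  wp M c T Q s -> (T <= T')%N -> wp M c T' Q s.
Proof. by move=> cTQ TT'; apply: wp_weaken cTQ TT' _. Qed.

(** * The phases of the algorithm, with their results and costs *)

Definition sum_exp (x y : iexp) : rexp := RAdd (RLower x y) (RUpper x y).

Definition cross_exp (x x' y y' : iexp) : rexp :=
  RSub (RSub (RAdd (sum_exp x y) (sum_exp x' y')) (sum_exp x y')) (sum_exp x' y).

Definition entry_sum (R : realType) (m n : nat) (M : interval_mx R m n)
    (x y : nat) : R :=
  entry (lower M) x y + entry (upper M) x y.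

Lemma entryE (R : realType) (m n : nat) (A : 'M[R]_(m, n)) (i : 'I_m) (j : 'I_n) :
  entry A i j = A i j.
Proof. by rewrite /entry !valK. Qed.

(* Index arrays: 0, 1, 2 are the outputs, 3 and 4 loop counters, 5 the reference
   column [e] (initially 0), 6 a rank counter.  Real arrays: 0 holds the sorting
   keys, 1 a partial sum. *)
Definition dist_cmd : cmd :=
  let d := cross_exp (INat 0) (ivar 3) (ivar 5) (ivar 4) in
  for_loop 4 ICols
    (Seq (RSet 1 (INat 0) (RNat 0))
    (Seq (for_loop 3 IRows
            (RSet 1 (INat 0) (RAdd (RGet 1 (INat 0)) (RMul d d))))
         (RSet 0 (ivar 4) (RGet 1 (INat 0))))).

Lemma wp_dist (R : realType) (m n : nat) (M : interval_mx R m n) s :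
  wp M dist_cmd (n * (m * 200 + 200) + 100)
    (fun s' => forall j, (j < n)%N -> rmem s' 0 j =
       \sum_(k < m) cross (entry_sum M) 0%N k (imem s 5 0) j ^+ 2) s.
Proof.
apply: wp_le; first apply: (@wp_for _ _ _ _ _ _ _ (m * 200 + 100) n
  (fun i s' => forall j, (j < i)%N -> rmem s' 0 j =
     \sum_(k < m) cross (entry_sum M) 0%N k (imem s 5 0) j ^+ 2)) => //.
- move=> i s' ltin pres vi Ii; apply: wp_le.
    apply: wp_seq; apply: wp_rset; apply: wp_seq.
    apply: wp_weaken; first apply: (@wp_for _ _ _ _ _ _ _ 120 m
      (fun k s1 => rmem s1 1 0 =
        \sum_(x < k) cross (entry_sum M) 0%N x (imem s 5 0) i ^+ 2)) => //.
    + by rewrite /update /= big_ord0.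
    + move=> k s1 ltkm pres1 vk Ik; apply: wp_le; first apply: wp_rset.
        rewrite /update /= big_ord_recr /= -Ik vk !pres1.1 //= vi !pres.1 //.
      by [].
    + exact: leqnn.
    + move=> s1 pres1 I1; apply: wp_rset; rewrite /update /= => j.
      rewrite ltnS leq_eqVlt pres1.1 //= vi I1.
      case: eqVneq => [->//|_ /= ltji].
      by rewrite pres1.2 //= /update /= Ii.
  by rewrite /=; lia.
- by rewrite /=; lia.
Qed.

Definition argmax_cmd : cmd :=
  for_loop 3 ICols
    (If (BRLe (RGet 0 (ivar 5)) (RGet 0 (ivar 3)))
       (ISet 5 (INat 0) (ivar 3)) Skip).

Lemma wp_argmax (R : realType) (m n : nat) (M : interval_mx R m n) s :
  (imem s 5 0 < n)%N ->
  wp M argmax_cmd (n * 100 + 100)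
    (fun s' => (imem s' 5 0 < n)%N /\
       forall l, (l < n)%N -> rmem s 0 l <= rmem s 0 (imem s' 5 0)) s.
Proof.
move=> e0n; apply: wp_le; first apply: (@wp_for _ _ _ _ _ _ _ 50 n
  (fun i s' => (imem s' 5 0 < n)%N /\
     forall l, (l < i)%N -> rmem s 0 l <= rmem s 0 (imem s' 5 0))) => //.
- move=> i s' ltin pres vi [e_lt emax]; apply: wp_le; first apply: wp_if.
  + rewrite /= vi !pres.2 // => le_e; apply: wp_le.
      apply: wp_iset; rewrite /update /= vi; split=> // l.
      rewrite ltnS leq_eqVlt => /predU1P[->//|/emax lel].
      exact: le_trans le_e.
    exact: leqnn.
  + rewrite /= vi !pres.2 // -ltNge => /ltW le_i; apply: wp_le.
      apply: wp_skip; rewrite /update /=; split=> // l.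
      by rewrite ltnS leq_eqVlt => /predU1P[->//|/emax].
    by [].
  + by [].
- by rewrite /=; lia.
Qed.

(** Writing each index at the position given by its rank inverts the rank permutation directly,
    without moving any data. *)
Definition rank_cmd (b : iexp) (out : nat) : cmd :=
  for_loop 3 b
    (Seq (ISet 6 (INat 0) (INat 0))
    (Seq (for_loop 4 b
            (If (BAnd (BRLe (RGet 0 (ivar 4)) (RGet 0 (ivar 3)))
                   (BNot (BAnd (BRLe (RGet 0 (ivar 3)) (RGet 0 (ivar 4)))
                            (BILe (ivar 3) (ivar 4)))))
               (ISet 6 (INat 0) (ISucc (ivar 6))) Skip))
         (ISet out (ivar 6) (ivar 3)))).

Lemma wp_rank (R : realType) (m n : nat) (M : interval_mx R m n) b (out : nat) N
    (p : 'S_N) s :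
  out \notin [:: 3; 4; 6]%N -> icost b = 1%N ->
  (forall s' : state R, ieval m n s' b = N) ->
  (forall j : 'I_N, rank N (rmem s 0) j = (p^-1)%g j) ->
  wp M (rank_cmd b out) (N * (N * 100 + 100) + 100)
    (fun s' => forall j : 'I_N, imem s' out j = p j) s.
Proof.
rewrite !inE !negb_or => /and3P[o3 o4 o6] b1 bN rankp.
apply: wp_weaken; first apply: (@wp_for _ _ _ _ _ _ _ (N * 70 + 50) N
  (fun i s' => forall l : 'I_N, (l < i)%N ->
     imem s' out (rank N (rmem s 0) l) = l)) => //.
- by rewrite /= !inE (eq_sym _ out) (negbTE o3).
- move=> i s' ltiN pres vi Ii; apply: wp_le.
    apply: wp_seq; apply: wp_iset; apply: wp_seq.
    apply: wp_weaken; first apply: (@wp_for _ _ _ _ _ _ _ 50 N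
      (fun k s1 => imem s1 6 0 =
        (\sum_(x < k) precedes (rmem s 0) x i)%N)) => //.
    + by rewrite /update /= big_ord0.
    + move=> k s1 ltkN pres1 vk Ik; rewrite big_ord_recr /= -Ik.
      have v3 : imem s1 3 0 = i by rewrite pres1.1.
      have r0 x : rmem s1 0 x = rmem s 0 x by rewrite pres1.2 //= pres.2.
      have -> : precedes (rmem s 0) k i = precedes (rmem s1 0) k i.
        by rewrite /precedes !r0.
      apply: wp_le; first apply: wp_if.
      * rewrite /= v3 vk -/(precedes (rmem s1 0) k i) => ->.
        apply: wp_le; first by apply: wp_iset; rewrite /update /= addn1.
        exact: leqnn.
      * rewrite /= v3 vk -/(precedes (rmem s1 0) k i) => /negbTE ->.
        apply: wp_le; first by apply: wp_skip; rewrite /update /= addn0.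
        by [].
      * by [].
    + exact: leqnn.
    + move=> s1 pres1 I1; apply: wp_iset; rewrite /update /= => l.
      rewrite (negbTE o3) /= I1 pres1.1 //= /update /= vi -/(rank N (rmem s 0) i).
      rewrite ltnS leq_eqVlt => /orP[/eqP ->|ltli]; first by rewrite !eqxx.
      (* Distinct indices have distinct ranks, so an entry written earlier survives. *)
      rewrite eqxx /= (rankp l) (rankp (Ordinal ltiN)) (inj_eq val_inj).
      rewrite (inj_eq perm_inj) -(inj_eq val_inj) /= (ltn_eqF ltli).
      rewrite -(rankp l) pres1.1; last by rewrite /= !inE !negb_or o4 o6.
      by rewrite /= /update (negbTE o6) /= Ii.
  by rewrite /= b1; lia.
- by rewrite b1; nia.
(* Position [j] is the rank of [p j], so every position has been filled. *)
- move=> s' _ I1 j; rewrite -[X in imem _ _ (nat_of_ord X)](permK p j).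
  by rewrite -rankp I1.
Qed.

(** Cells 0 and n-1 of array 2 hold the first and last sorted columns, so this is the key of
    [compatible_ends]. *)
Definition row_key_cmd : cmd :=
  for_loop 3 IRows
    (RSet 0 (ivar 3) (RSub (sum_exp (ivar 3) (IGet 2 (INat 0)))
                           (sum_exp (ivar 3) (IGet 2 (IPred ICols))))).

Lemma wp_row_key (R : realType) (m n : nat) (M : interval_mx R m n) s :
  wp M row_key_cmd (m * 100 + 100)
    (fun s' => forall i, (i < m)%N -> rmem s' 0 i =
       entry_sum M i (imem s 2 0) - entry_sum M i (imem s 2 n.-1)) s.
Proof.
apply: wp_le; first apply: (@wp_for _ _ _ _ _ _ _ 50 m
  (fun k s' => forall i, (i < k)%N -> rmem s' 0 i =
       entry_sum M i (imem s 2 0) - entry_sum M i (imem s 2 n.-1))) => //.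
- move=> k s' ltkm pres vk Ik; apply: wp_le; first apply: wp_rset.
    rewrite /update /= => i; rewrite vk ltnS leq_eqVlt.
    case: eqVneq => [->|_ /= /Ik //]; by rewrite !pres.1.
  by [].
- by rewrite /=; lia.
Qed.

(** The flag starts at YES and is only ever lowered. Both bounds stop one short because each test
    reads the next index too; a single row or column leaves YES. *)
Definition check_cmd : cmd :=
  let s0 := IGet 1 (ivar 3) in let s1 := IGet 1 (ISucc (ivar 3)) in
  let p0 := IGet 2 (ivar 4) in let p1 := IGet 2 (ISucc (ivar 4)) in
  Seq (ISet 0 (INat 0) (INat 1))
    (for_loop 3 (IPred IRows) (for_loop 4 (IPred ICols)
       (If (BRLe (RAdd (RUpper s0 p0) (RUpper s1 p1))
                 (RAdd (RLower s0 p1) (RLower s1 p0)))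
          Skip (ISet 0 (INat 0) (INat 0))))).

Definition adjacent_monge (R : realType) (m n : nat) (M : interval_mx R m n)
    (f g : nat -> nat) (i j : nat) : bool :=
  entry (upper M) (f i) (g j) + entry (upper M) (f i.+1) (g j.+1)
    <= entry (lower M) (f i) (g j.+1) + entry (lower M) (f i.+1) (g j).

Lemma all_iota_recr (a : pred nat) k :
  all a (iota 0 k.+1) = all a (iota 0 k) && a k.
Proof. by rewrite -addn1 iotaD all_cat /= add0n andbT. Qed.

Lemma wp_check (R : realType) (m n : nat) (M : interval_mx R m n) s :
  wp M check_cmd (m * (n * 100 + 100) + 100)
    (fun s' => imem s' 0 0 =
       all (fun i => all (adjacent_monge M (imem s 1) (imem s 2) i)
                       (iota 0 n.-1)) (iota 0 m.-1) :> nat) s.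
Proof.
apply: wp_le.
  apply: wp_seq; apply: wp_iset.
  apply: (@wp_for _ _ _ _ _ _ _ (n * 70 + 50) m.-1
    (fun k s' => imem s' 0 0 =
       all (fun i => all (adjacent_monge M (imem s 1) (imem s 2) i)
                       (iota 0 n.-1)) (iota 0 k) :> nat)) => //.
  move=> i s1 ltim pres1 vi Ii; apply: wp_le.
    (* [b] is the verdict on the earlier rows, carried through the inner loop. *)
    rewrite all_iota_recr; set b := all _ _ in Ii *.
    apply: (@wp_for _ _ _ _ _ _ _ 50 n.-1
      (fun k s' => imem s' 0 0 =
        b && all (adjacent_monge M (imem s 1) (imem s 2) i) (iota 0 k) :> nat)) => //.
      by rewrite /update /= andbT.
    move=> j s2 ltjn pres2 vj Ij; rewrite all_iota_recr andbA /=.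
    have v3 : imem s2 3 0 = i by rewrite pres2.1.
    have i1 k : imem s2 1 k = imem s 1 k by rewrite pres2.1 //= pres1.1.
    have i2 k : imem s2 2 k = imem s 2 k by rewrite pres2.1 //= pres1.1.
    apply: wp_le; first apply: (@wp_if _ _ _ _ _ _ _ 4).
    + rewrite /= v3 vj !i1 !i2 => adj; apply: wp_le.
        by apply: wp_skip; rewrite /update /= /adjacent_monge adj andbT.
      by [].
    + rewrite /= v3 vj !i1 !i2 => /negbTE adj; apply: wp_le.
        by apply: wp_iset; rewrite /update /= /adjacent_monge adj andbF.
      by [].
    + by [].
  by rewrite /=; lia.
by rewrite /=; nia.
Qed.

Lemma adjacent_mongeP (R : realType) (m n : nat) (M : interval_mx R m n)
    (f g : nat -> nat) (s : 'S_m) (p : 'S_n) :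
  (forall i : 'I_m, f i = s i) -> (forall j : 'I_n, g j = p j) ->
  reflect (strong_monge (permute_mx M s p))
    (all (fun i => all (adjacent_monge M f g i) (iota 0 n.-1)) (iota 0 m.-1)).
Proof.
move=> fs gp.
have adjE (i i' : 'I_m) (j j' : 'I_n) : i' = i.+1 :> nat -> j' = j.+1 :> nat ->
    adjacent_monge M f g i j = interval_monge4 (permute_mx M s p) i i' j j'.
  move=> ii' jj'; rewrite /adjacent_monge -ii' -jj' !fs !gp !entryE.
  by rewrite /interval_monge4 /= !mxE.
apply: (iffP allP) => [adj|sM i].
  apply: strong_monge_adjacent => i i' j j' ii' jj'.
  rewrite -(adjE i i' j j') //.
  have := ltn_ord i'; have := ltn_ord j'; rewrite ii' jj' => jn im.
  have /allP : all (adjacent_monge M f g i) (iota 0 n.-1).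
    by apply: adj; rewrite mem_iota /=; lia.
  by apply; rewrite mem_iota /=; lia.
rewrite mem_iota /= => ltim; apply/allP => j; rewrite mem_iota /= => ltjn.
(* The shortened ranges keep the successors inside the matrix, so the default value of [entry] is
   never met. *)
have [im im' jn jn'] : [/\ i < m, i.+1 < m, j < n & j.+1 < n]%N by split; lia.
rewrite (adjE (Ordinal im) (Ordinal im') (Ordinal jn) (Ordinal jn')) //.
by move/strong_mongeP: sM; apply.
Qed.

(** * The whole algorithm *)

Definition monge_cmd : cmd :=
  Seq dist_cmd (Seq argmax_cmd (Seq dist_cmd (Seq (rank_cmd ICols 2)
    (Seq row_key_cmd (Seq (rank_cmd IRows 1) check_cmd))))).

Lemma entry_sumE (R : realType) (m n : nat) (M : interval_mx R m n)
    (x : 'I_m) (y : 'I_n) : entry_sum M x y = endpoint_sum M x y.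
Proof. by rewrite /entry_sum !entryE. Qed.

Lemma sum_cross_sqdist (R : realType) (m n : nat) (M : interval_mx R m n)
    (x0 : 'I_m) (y y' : 'I_n) :
  \sum_(k < m) cross (entry_sum M) x0 k y y' ^+ 2 =
  sqdist (endpoint_sum M) x0 y y'.
Proof. by apply: eq_bigr => k _; rewrite /cross !entry_sumE. Qed.

Lemma sorted_ends (R : realType) (n : nat) (key : nat -> R) (p : 'S_n)
    (j0 j1 : 'I_n) :
  (forall i k : 'I_n, (i < k)%N -> key (p i) <= key (p k)) ->
  j0 = 0%N :> nat -> j1 = n.-1 :> nat ->
  forall y : 'I_n, key (p j0) <= key y <= key (p j1).
Proof.
move=> sorted j00 j1n y; rewrite -(permKV p y); set z := (p^-1)%g y.
have mono (i k : 'I_n) : (i <= k)%N -> key (p i) <= key (p k).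
  by rewrite leq_eqVlt => /orP[/eqP/val_inj -> //|]; exact: sorted.
by rewrite !mono //= ?j00 // j1n; have := ltn_ord z; lia.
Qed.

(** Ranks form permutations for any keys, so [sigma] and [pi] exist on every input; only the last
    clause assumes permutability. *)
Lemma wp_monge (R : realType) (m n : nat) (M : interval_mx R m n) :
  (0 < m)%N -> (0 < n)%N ->
  exists2 T, (T <= 3000 * (m ^ 2 + n ^ 2 + m * n))%N &
  wp M monge_cmd T (fun s => exists (sigma : 'S_m) (pi : 'S_n),
    [/\ forall i : 'I_m, imem s 1 i = sigma i,
        forall j : 'I_n, imem s 2 j = pi j,
        imem s 0 0 = all (fun i => all (adjacent_monge M (imem s 1) (imem s 2) i)
                       (iota 0 n.-1)) (iota 0 m.-1) :> nat &
        monge_permutable M -> strong_monge (permute_mx M sigma pi)])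
    (init_state R).
Proof.
move=> m_gt0 n_gt0; pose x0 := Ordinal m_gt0; pose y0 := Ordinal n_gt0.
(* The bound [T] is left open and collected from the phases. *)
eexists; last first.
  apply: wp_seq; apply: wp_weaken (wp_dist M _) (leqnn _) _ => s1 pres1 dist1.
  (* Memory starts at 0, so the first pass measures distances from column 0; the second one measures
     them from the farthest column [e]. *)
  have e0 : imem s1 5 0 = 0%N by rewrite pres1.1.
  apply: wp_seq; apply: wp_weaken (@wp_argmax _ _ _ M s1 _) (leqnn _) _ => [|s2 pres2 [e_lt emax]].
    by rewrite e0.
  pose e := Ordinal e_lt.
  apply: wp_seq; apply: wp_weaken (wp_dist M _) (leqnn _) _ => s3 pres3 dist3.
  have [p [rankp sortp]] := rank_perm n (rmem s3 0).
  apply: wp_seq; apply: wp_weaken (@wp_rank _ _ _ M ICols 2 n p s3 _ _ _ _) (leqnn _) _ => //.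
  move=> s4 pres4 s4p.
  apply: wp_seq; apply: wp_weaken (wp_row_key M _) (leqnn _) _ => s5 pres5 key5.
  have [s [ranks sorts]] := rank_perm m (rmem s5 0).
  apply: wp_seq; apply: wp_weaken (@wp_rank _ _ _ M IRows 1 m s s5 _ _ _ _) (leqnn _) _ => //.
  move=> s6 pres6 s6s.
  apply: wp_weaken (wp_check M _) (leqnn _) _ => s7 pres7 ans.
  exists s, p; split.
  - by move=> i; rewrite pres7.1.
  - by move=> j; rewrite pres7.1 // pres6.1 // pres5.1.
  - rewrite ans; congr (nat_of_bool _); apply: eq_all => i; apply: eq_all => j.
    by rewrite /adjacent_monge !pres7.1.
  move=> permM; have [r [c Arc]] := compatible_permutable permM.
  have dist3E (y : 'I_n) : rmem s3 0 y = sqdist (endpoint_sum M) x0 e y.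
    by rewrite dist3 // -sum_cross_sqdist.
  have [r' Ar'] : exists r', compatible (endpoint_sum M) r' (sqdist (endpoint_sum M) x0 e).
    apply: (compatible_sqdist (y0 := y0) Arc) => y.
    rewrite -!sum_cross_sqdist; have := emax _ (ltn_ord y).
    by rewrite !dist1 //= ?e0.
  have n1 : (n.-1 < n)%N by lia.
  (* In the order by distance from [e], the ends are the first and last columns of the sorting
     permutation [p]. *)
  have Hr := compatible_ends (p := p y0) (q := p (Ordinal n1)) Ar' _.
  apply: (strong_monge_sorted permM (Hr _)).
  + by move=> y; rewrite -!dist3E; exact: (sorted_ends sortp).
  + move=> i k /sorts; rewrite !key5 // -[0%N]/(y0 : nat) -[n.-1]/(Ordinal n1 : nat).
    by rewrite !s4p !entry_sumE.
  + by move=> j l /sortp; rewrite !dist3E.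
(* Since [m] and [n] are at least 1, the quadratic terms absorb the linear and constant ones. *)
by rewrite !expnS; nia.
Qed.

Theorem theorem6p2 (R : realType) :
  exists (P : cmd) (C : nat),
  forall (m n : nat) (M : interval_mx R m n), (0 < m)%N -> (0 < n)%N ->
  exists (t : nat) (s : state R),
    [/\ exec M P (init_state R) t s,
        (t <= C * (m ^ 2 + n ^ 2 + m * n))%N,
        monge_permutable M ->
          exists (sigma : 'S_m) (pi : 'S_n),
            outputs_yes s sigma pi /\ strong_monge (permute_mx M sigma pi)
      & ~ monge_permutable M -> outputs_no s].
Proof.
exists monge_cmd, 3000%N => m n M m_gt0 n_gt0.
have [T leT [t [s [es tT [sigma [pi [s1 s2 ans sM]]]]]]] := wp_monge M m_gt0 n_gt0.
exists t, s; split=> //; first exact: leq_trans leT.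
  move=> /sM {}sM; exists sigma, pi; split=> //; split=> //.
  by rewrite ans; have /(adjacent_mongeP M s1 s2) -> := sM.
move=> npermM; rewrite /outputs_no ans.
(* A successful test would itself make the computed permutations a witness of permutability. *)
by case: (adjacent_mongeP M s1 s2) => // sM'; case: npermM; exists sigma, pi.
Qed.
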